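(* Define polynomials $P_k$ ($k\ge2$) over $\mathbb{Q}$ in the variables $u_1,u_2,\dots$ by $P_2=u_2-u_1^2$ and $$P_{k+1}=\frac1{k+2}\left(\sum_{i=1}^k\big((i+2)u_{i+1}-2u_1u_i\big)\frac{\partial P_k}{\partial u_i}-2ku_1P_k-\sum_{i=2}^{k-1}P_iP_{k+1-i}\right)\quad\text{for }k\ge2.$$ Then for every integer $k>1$, $$P_k(u_1,u_2,\dots,u_k)=\frac1{1-k}P_{0k}^{(1-k)}(1,u_1,u_2,\dots,u_k).$$
   Context: For a nonzero element $a$ of a field of characteristic $0$ and an integer $m\ge0$, the polynomials $P_{mk}^{(a)}$ are defined by $$\sum_{k=1}^{\infty}P_{mk}^{(a)}(x_0,x_1,\dots,x_{m+k})z^k=\frac{\left(\sum_{i=0}^{\infty}x_ix_0^{i-1}z^i\right)^{a}-\left(\sum_{i=0}^{m}x_ix_0^{i-1}z^i\right)^{a}}{x_0^mz^m},$$ where the series have constant term $1$ in $z$ and powers are given by the binomial series. An empty sum is $0$. *)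

(* Defs.v *)
From mathcomp Require Import all_boot all_algebra.
From mathcomp.multinomials Require Import mpoly.
From mathcomp Require Import zify.

Set Implicit Arguments.
Unset Strict Implicit.
Unset Printing Implicit Defensive.

Import GRing.Theory.

Local Open Scope ring_scope.

Definition gbinom (F : fieldType) (a : F) (n : nat) : F :=
  (\prod_(i < n) (a - i%:R)) / (n`!)%:R.

(* A power series in z is given by its sequence of coefficients. For f with
   constant term 1, spow f a is the binomial series \sum_n gbinom a n (f - 1)^n.
   Since (f - 1)^n has order at least n, its coefficient of z^k only involves
   the terms n <= k and the coefficients of f up to order k. *)
Definition spow (F : fieldType) (A : comAlgType F) (f : nat -> A) (a : F)
    (k : nat) : A :=
  \sum_(n < k.+1) gbinom a n *: ((\poly_(i < k.+1) f i - 1) ^+ n)`_k.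

(* The series \sum_i x_i x_0^(i-1) z^i, with constant term x_0 x_0^(-1) = 1, in
   the variables x_0, ..., x_l. Its coefficients are meaningful up to order l;
   they are only used up to that order. *)
Definition xser (F : fieldType) (l i : nat) : {mpoly F[l.+1]} :=
  if i is j.+1 then 'X_(inord i) * 'X_ord0 ^+ j else 1.

Definition xser_trunc (F : fieldType) (l m i : nat) : {mpoly F[l.+1]} :=
  if (i <= m)%N then xser F l i else 0.

Definition Pmk_num (F : fieldType) (a : F) (l m j : nat) : {mpoly F[l.+1]} :=
  spow (xser F l) a j - spow (xser_trunc F l m) a j.

(* Division by x_0 ^ m, monomial by monomial. *)
Definition divX0 (F : fieldType) (l m : nat) (p : {mpoly F[l.+1]}) :
    {mpoly F[l.+1]} :=
  \sum_(c <- msupp p) p@_c *: 'X_[c - U_(ord0) *+ m].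

(* P_{mk}^{(a)} in the variables x_0, ..., x_{m+k}, for F of characteristic 0
   and a != 0. The division is exact: see Pmk_spec. *)
Definition Pmk (F : fieldType) (a : F) (m k : nat) :
    {mpoly F[(m + k).+1]} :=
  divX0 m (Pmk_num a (m + k) m (m + k)).

(* The variable u_i of F[u_1, ..., u_n]. Since indices of {mpoly F[n]} start at
   0, it is 'X_(i-1). It is set to 0 outside of 1 <= i <= n. *)
Definition uvar (F : fieldType) (n i : nat) : {mpoly F[n]} :=
  if i is j.+1 then oapp (fun o : 'I_n => 'X_o) 0 (insub j) else 0.

Definition uderiv (F : fieldType) (n i : nat) (p : {mpoly F[n]}) :
    {mpoly F[n]} :=
  if i is j.+1 then oapp (fun o : 'I_n => p^`M(o)) 0 (insub j) else 0.

Definition Pu_next (F : fieldType) (n k : nat) (P : nat -> {mpoly F[n]}) :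
    {mpoly F[n]} :=
  (k.+2%:R)^-1 *:
    (\sum_(1 <= i < k.+1)
        (uvar F n i.+1 *+ (i + 2) - uvar F n 1 * uvar F n i *+ 2)
        * uderiv i (P k)
     - uvar F n 1 * P k *+ (2 * k)
     - \sum_(2 <= i < k) P i * P (k.+1 - i)%N).

(* Pu_upto F n k i is P_i for 2 <= i <= k, and 0 for the other i. *)
Fixpoint Pu_upto (F : fieldType) (n k : nat) : nat -> {mpoly F[n]} :=
  match k with
  | 0 => fun _ => 0
  | k'.+1 => fun i =>
      if i != k'.+1 then Pu_upto F n k' i
      else if k' == 0 then 0
      else if k' == 1 then uvar F n 2 - uvar F n 1 ^+ 2
      else Pu_next k' (Pu_upto F n k')
  end.

(* P_k for k >= 2. As P_k only involves u_1, ..., u_k, it is viewed as an element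
   of F[u_1, ..., u_n] for any n >= k; this is independent of n by Pu_widen. *)
Definition Pu (F : fieldType) (n k : nat) : {mpoly F[n]} := Pu_upto F n k k.

Lemma Pu2 (F : fieldType) n : Pu F n 2 = uvar F n 2 - uvar F n 1 ^+ 2.
Proof. by []. Qed.

Lemma Pu_uptoE (F : fieldType) n k i :
  (i <= k)%N -> Pu_upto F n k i = Pu F n i.
Proof.
elim: k => [|k IHk]; first by rewrite leqn0 => /eqP ->.
rewrite leq_eqVlt => /orP[/eqP -> //|lt_ik] /=.
by rewrite (ltn_eqF lt_ik) /= IHk.
Qed.

Lemma PuS (F : fieldType) n k :
  (2 <= k)%N -> Pu F n k.+1 = Pu_next k (Pu F n).
Proof.
case: k => [|[|k]] // _.
have -> : Pu F n k.+3 = Pu_next k.+2 (Pu_upto F n k.+2).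
  have uptoS l i : Pu_upto F n l.+3 i =
    if i != l.+3 then Pu_upto F n l.+2 i else Pu_next l.+2 (Pu_upto F n l.+2).
    by [].
  by rewrite {1}/Pu uptoS eqxx.
rewrite /Pu_next Pu_uptoE //; congr (_ *: (_ - _)).
apply: eq_big_nat => i /andP[i_ge2 lt_ik].
by rewrite !Pu_uptoE //; lia.
Qed.

Lemma mwiden_mderiv (F : fieldType) n (i : 'I_n) (p : {mpoly F[n]}) :
  (mwiden p)^`M(widen_ord (leqnSn n) i) = mwiden p^`M(i).
Proof.
elim/mpolyind: p => [|c m p _ _ IHp]; first by rewrite !(mderiv0, mwiden0).
rewrite mwidenD !mderivD mwidenD IHp mwidenZ !mderivZ mwidenZ.
congr (_ *: _ + _); rewrite mwidenX !mderivX mwidenZ mwidenX mnmwiden_widen.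
case: (posnP (m i)) => [->|mi_gt0]; first by rewrite !scale0r.
have le_m : (U_(i) <= m)%MM by rewrite lep1mP -lt0n.
by rewrite -{2}(submK le_m) mnmwidenD mnmwiden1 addmK.
Qed.

Lemma mwiden_uvar (F : fieldType) n i :
  (i <= n)%N -> mwiden (uvar F n i) = uvar F n.+1 i.
Proof.
case: i => [|i] lt_in /=; first by rewrite mwiden0.
rewrite !insubT ?(leqW lt_in) //= => lt_iSn.
rewrite mwidenX mnmwiden1; congr 'X_[U_(_)]; exact: val_inj.
Qed.

Lemma mwiden_uderiv (F : fieldType) n i (p : {mpoly F[n]}) :
  (i <= n)%N -> uderiv i (mwiden p) = mwiden (uderiv i p).
Proof.
case: i => [|i] lt_in /=; first by rewrite mwiden0.
rewrite !insubT ?(leqW lt_in) //= => lt_iSn.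
by rewrite -mwiden_mderiv; congr (_^`M(_)); apply: val_inj.
Qed.

Lemma Pu_widen (F : fieldType) n k :
  (k <= n)%N -> mwiden (Pu F n k) = Pu F n.+1 k.
Proof.
elim/ltn_ind: k => -[|[|[|k]]] IHk le_kn; rewrite ?mwiden0 //.
  by rewrite !Pu2 !expr2 mwidenB mwidenM !mwiden_uvar // ltnW.
have IH i : (i <= k.+2)%N -> mwiden (Pu F n i) = Pu F n.+1 i.
  by move=> le_ik; apply: IHk => //; lia.
have u i : (i <= k.+3)%N -> mwiden (uvar F n i) = uvar F n.+1 i.
  by move=> le_ik; apply: mwiden_uvar; lia.
rewrite !PuS // /Pu_next mwidenZ !mwidenB (mwidenMn (_ * _)) mwidenM IH // u //.
have wsum r (f : nat -> {mpoly F[n]}) :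
  mwiden (\sum_(i <- r) f i) = \sum_(i <- r) mwiden (f i) by exact: raddf_sum.
congr (_ *: (_ - _ - _)); rewrite wsum; apply: eq_big_nat => i /andP[i_ge lt_ik].
  rewrite mwidenM -mwiden_uderiv ?IH //; last by lia.
  by rewrite mwidenB !mwidenMn mwidenM !u //; lia.
by rewrite mwidenM !IH //; lia.
Qed.

Lemma divX0K (F : fieldType) l m (p : {mpoly F[l.+1]}) :
  divX0 m ('X_ord0 ^+ m * p) = p.
Proof.
rewrite mpolyXn; set t := (U_(ord0) *+ m)%MM.
have suppE : perm_eq (msupp ('X_[t] * p)) [seq (t + c)%MM | c <- msupp p].
  by rewrite mulrC msuppMX.
rewrite /divX0 (perm_big _ suppE) big_map [RHS]mpolyE.
by apply: eq_bigr => c _; rewrite mulrC mcoeffMX addmC addmK.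
Qed.

Lemma eq_spow (F : fieldType) (A : comAlgType F) (f g : nat -> A) (a : F) k :
  (forall i, (i <= k)%N -> f i = g i) -> spow f a k = spow g a k.
Proof.
move=> eq_fg; suff eqP : \poly_(i < k.+1) f i = \poly_(i < k.+1) g i.
  by rewrite /spow eqP.
by apply/polyP => i; rewrite !coef_poly; case: ltnP => // /eq_fg.
Qed.

Lemma Pmk_num0 (F : fieldType) (a : F) l m j :
  (j <= m)%N -> Pmk_num a l m j = 0.
Proof.
move=> le_jm; apply/eqP; rewrite subr_eq0; apply/eqP/eq_spow => i le_ij.
by rewrite /xser_trunc (leq_trans le_ij le_jm).
Qed.

Lemma Pmk_num_dvd (F : fieldType) (a : F) l m j :
  exists q, Pmk_num a l m j = 'X_ord0 ^+ m * q.
Proof.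
rewrite /Pmk_num /spow -sumrB.
pose dvd (p : {mpoly F[l.+1]}) := exists q, p = 'X_ord0 ^+ m * q.
have dvdD p q : dvd p -> dvd q -> dvd (p + q).
  by move=> [p' ->] [q' ->]; exists (p' + q'); rewrite mulrDr.
have dvd0 : dvd 0 by exists 0; rewrite mulr0.
have dvdM p q : dvd p -> dvd (p * q).
  by move=> [p' ->]; exists (p' * q); rewrite mulrA.
rewrite -/(dvd _); apply: (big_ind dvd) => // n _.
rewrite -scalerBr -coefB subrXX opprB addrA subrK coefM.
rewrite -mulr_algr; apply: (dvdM _ _); apply: (big_ind dvd) => // i _.
apply: (dvdM _ _).
rewrite coefB !coef_poly; case: ifP => _; last by rewrite subr0.
rewrite /xser_trunc; case: leqP => [_|lt_mi]; first by rewrite subrr.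
rewrite subr0; case: (i : nat) lt_mi => // k lt_mk.
by exists ('X_(inord k.+1) * 'X_ord0 ^+ (k - m)); rewrite mulrCA -exprD subnKC.
Qed.

Lemma Pmk_spec (F : fieldType) (a : F) m k :
  'X_ord0 ^+ m * Pmk a m k = Pmk_num a (m + k) m (m + k).
Proof.
by rewrite /Pmk; have [q ->] := Pmk_num_dvd a (m + k) m (m + k); rewrite divX0K.
Qed.

(* Main.v *)
Require Import Defs.
From mathcomp Require Import all_boot all_algebra.
From mathcomp.multinomials Require Import mpoly.
From mathcomp Require Import zify ring.

Set Implicit Arguments.
Unset Strict Implicit.
Unset Printing Implicit Defensive.

Import GRing.Theory.

Local Open Scope ring_scope.

(** Let f = 1 + u_1 z + u_2 z^2 + ..., and write c(a, n) for the coefficient of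
z^n in f^a. Let Q be the series with Q(z f(z)) = f(z). By Lagrange inversion its
coefficients are q_0 = 1, q_1 = u_1 and q_n = c(1 - n, n) / (1 - n) for n > 1,
so the claim is that P_n = q_n. The case n = 2 is a direct computation, and it
remains to see that q_n satisfies the recurrence.

The first part of the recurrence is the derivation D with
D u_i = (i + 2) u_(i+1) - 2 u_1 u_i, that is, D f = f' + (f - 1) / z - 2 u_1 f.
The chain rule for D (f^a) (power_rule) at a = 1 - k expresses D q_k through
q_k, q_(k+1) and c(1 - k, k + 1). The last of these is not a multiple of a single
q_i, but of the convolution \sum_i q_i q_(k+1-i), which is where the quadratic
part of the recurrence comes from (inv_coef_square): this convolution is the
coefficient of Q^2 and is again given by Lagrange inversion.

Only integer exponents a occur, so that the family c is determined by
c(0, n) = [n = 0] and f^(a+1) = f f^a; for the binomial series the latter is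
Pascal's rule (spow_powers). A family X(a, n) with X(a + 1) = f X(a) vanishes as
soon as each X(_, n) vanishes for a single a, since by induction on n it does not
depend on a (conv_shift_eq0). This proves the chain rule, starting from a = 0,
as well as Lagrange inversion, in the form

  \sum_i (i - 1) q_i [z^(n-i)] f^(a+i) (1 + z f' / f) = - c(a + 1, n),

which results from 1 / z = \sum_i q_i (z f)^(i-1) by applying z d/dz and
multiplying by z f^(a+1). For a = - n all but the last term of the sum vanish, because
(z f)^(-m) (1 + z f' / f) has the constant term 0 for m > 0. For a = 1 - n the
left-hand side is \sum_i (i - 1) q_i q_(n-i), and exchanging i and n - i gives
(n - 2) \sum_i q_i q_(n-i) = - 2 c(2 - n, n). *)

(** * Cauchy products of sequences *)

Definition conv (A : nzRingType) (s t : nat -> A) (n : nat) : A :=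
  \sum_(i < n.+1) s i * t (n - i)%N.

Lemma exchange_triangle (V : nmodType) (n : nat) (F : nat -> nat -> V) :
  \sum_(i < n.+1) \sum_(j < (n - i).+1) F i j =
  \sum_(j < n.+1) \sum_(i < (n - j).+1) F i j.
Proof.
have widen (G : nat -> V) i : (i <= n)%N ->
    \sum_(j < (n - i).+1) G j = \sum_(j < n.+1 | (i + j <= n)%N) G j.
  move=> le_in; rewrite (big_ord_widen n.+1 G) ?ltnS ?leq_subr //.
  by apply: eq_bigl => j; rewrite ltnS leq_subRL.
under eq_bigr => i _ do rewrite (widen (F i)) -1?ltnS //.
rewrite (exchange_big_dep predT) //=; apply: eq_bigr => j _.
rewrite (widen (F^~ j)) -1?ltnS //.
by apply: eq_bigl => i; rewrite addnC.
Qed.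

(** The sequence t may vary with i: this is what lets convolution with u pass
through \sum_i s_i f^(a+i), where the exponent moves with i. *)
Lemma conv_exchange (A : comNzRingType) (u s : nat -> A) (t : nat -> nat -> A) n :
  \sum_(i < n.+1) s i * conv u (t i) (n - i) =
  conv u (fun m => \sum_(i < m.+1) s i * t i (m - i)%N) n.
Proof.
rewrite /conv; under eq_bigr => i _ do rewrite mulr_sumr.
rewrite (exchange_triangle n (fun i j => s i * (u j * t i (n - i - j)%N))).
apply: eq_bigr => j _; rewrite mulr_sumr; apply: eq_bigr => i _.
by rewrite mulrCA subnAC.
Qed.

Lemma convCA (A : comNzRingType) (u s t : nat -> A) n :
  conv s (conv u t) n = conv u (conv s t) n.
Proof. exact: (conv_exchange u s (fun=> t)). Qed.

Lemma eq_convr (A : nzRingType) (s t t' : nat -> A) n :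
  t =1 t' -> conv s t n = conv s t' n.
Proof. by move=> eq_t; apply: eq_bigr => i _; rewrite eq_t. Qed.

Lemma convDr (A : nzRingType) (s t t' : nat -> A) n :
  conv s (fun m => t m + t' m) n = conv s t n + conv s t' n.
Proof. by rewrite -big_split; apply: eq_bigr => i _; rewrite mulrDr. Qed.

Lemma convBr (A : nzRingType) (s t t' : nat -> A) n :
  conv s (fun m => t m - t' m) n = conv s t n - conv s t' n.
Proof. by rewrite /conv -sumrB; apply: eq_bigr => i _; rewrite mulrBr. Qed.

Lemma convZr (A : comNzRingType) (s t : nat -> A) x n :
  conv s (fun m => x * t m) n = x * conv s t n.
Proof. by rewrite mulr_sumr; apply: eq_bigr => i _; rewrite mulrCA. Qed.

Lemma conv_recl (A : nzRingType) (s t : nat -> A) n :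
  conv s t n.+1 = s 0%N * t n.+1 + conv (fun i => s i.+1) t n.
Proof. by rewrite /conv big_ord_recl subn0. Qed.

(** Since u_0 = 1, the value X a n changes from a to a + 1 only by a combination
of the X a m with m < n, which are 0 by induction. *)
Lemma conv_shift_eq0 (A : nzRingType) (u : nat -> A) (X : int -> nat -> A) :
    u 0%N = 1 -> (forall a n, X (a + 1) n = conv u (X a) n) ->
    (forall n, exists a, X a n = 0) ->
  forall a n, X a n = 0.
Proof.
move=> u0 XS X0 a n; elim/ltn_ind: n a => n IHn.
have step a : X (a + 1) n = X a n.
  rewrite XS /conv big_ord_recl u0 mul1r subn0 big1 ?addr0 // => i _.
  by rewrite IHn ?mulr0 //=; have := ltn_ord i; rewrite /bump; lia.
have const a : X a n = X 0 n.
  elim/int_ind: a => // m IHm.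
    by rewrite -IHm -[RHS]step; congr (X _ n); lia.
  by rewrite -IHm -[LHS]step; congr (X _ n); lia.
by have [b Xb] := X0 n; move=> a; rewrite const -(const b).
Qed.

(** * Integer powers of a power series *)

(** The family c a n is the coefficient of z^n in the a-th power of the series u,
for a an integer of either sign: going down from a + 1 to a is the division by u,
which is possible since its constant term is 1. *)
Definition powers (A : nzRingType) (u : nat -> A) (c : int -> nat -> A) : Prop :=
  [/\ u 0%N = 1, forall n, c 0 n = (n == 0%N)%:R
    & forall a n, c (a + 1) n = conv u (c a) n].

Section Powers.

Variables (A : comNzRingType) (u : nat -> A) (c : int -> nat -> A).
Hypothesis c_pow : powers u c.

(** The chain rule d (f^a) = a f^(a-1) d f. The hypotheses on d say that it acts
as a derivation of the series ring, with an action on the coefficient of z^m that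
may depend on m; both z d/dz and the derivations of the coefficient ring are of
this kind. *)
Lemma power_rule (d : nat -> A -> A) :
    (forall m, {morph d m : x y / x + y}) ->
    (forall i j x y, d (i + j)%N (x * y) = d i x * y + x * d j y) ->
  forall a n, d n (c a n) = a%:~R * conv (fun i => d i (u i)) (c (a - 1)) n.
Proof.
have [u0 c0 cS] := c_pow.
move=> dD dM a n; apply/eqP; rewrite -subr_eq0; apply/eqP.
have d0 m : d m 0 = 0.
  by apply: (@addrI _ (d m 0)); rewrite -dD !addr0.
have d1 : d 0%N 1 = 0.
  apply: (@addrI _ (d 0%N 1)); rewrite addr0 -[in RHS](mulr1 1).
  by rewrite (dM 0%N 0%N) mulr1 mul1r.
pose X a n := d n (c a n) - a%:~R * conv (fun i => d i (u i)) (c (a - 1)) n.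
rewrite -/(X a n); apply: (conv_shift_eq0 u0) => {a n} [a n|n]; last first.
  exists 0; rewrite /X c0 mul0r subr0; case: n => [|n] //=; exact: d1.
have dconv s t : d n (conv s t n) =
    conv (fun i => d i (s i)) t n + conv s (fun i => d i (t i)) n.
  rewrite /conv (big_morph _ (dD n) (d0 n)) -big_split; apply: eq_bigr => i _ /=.
  by rewrite -dM subnKC // -ltnS.
have cE s : conv s (conv u (c (a - 1))) n = conv s (c a) n.
  by apply: eq_convr => m; rewrite -cS subrK.
have eq_d : d n (c (a + 1) n) = d n (conv u (c a) n) by rewrite cS.
rewrite /X eq_d dconv addrK convBr convZr -convCA cE intrD; ring.
Qed.

(** The coefficient of z^n in f^a (1 + z f' / f), where f is the series u. *)
Definition wpow (a : int) (n : nat) : A :=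
  c a n + conv (fun i => i%:R * u i) (c (a - 1)) n.

Lemma wpowS a n : wpow (a + 1) n = conv u (wpow a) n.
Proof.
have [u0 c0 cS] := c_pow.
rewrite /wpow cS convDr convCA; congr (_ + _).
by apply: eq_convr => m; rewrite addrK -cS subrK.
Qed.

Lemma wpowE a n : a%:~R * wpow a n = (a + n%:Z)%:~R * c a n.
Proof.
rewrite mulrDr -(power_rule (d := fun i x => i%:R * x)); first by rewrite intrD; ring.
  by move=> m x y; rewrite mulrDr.
by move=> i j x y; rewrite natrD; ring.
Qed.

(** The coefficients of Q, with Q (z f) = f. Unlike c (1 - n) n / (1 - n), this
expression needs no division and gives the right value also for n = 1. *)
Definition inv_coef (n : nat) : A := wpow (1 - n%:Z) n.

Lemma inv_coefE n : (1 - n%:Z)%:~R * inv_coef n = c (1 - n%:Z) n.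
Proof. by rewrite wpowE subrK mul1r. Qed.

Lemma pow_at0 a : c a 0 = 1.
Proof.
have [u0 c0 cS] := c_pow.
have step b : c (b + 1) 0 = c b 0 by rewrite cS /conv big_ord1 u0 mul1r.
elim/int_ind: a => [|m IHm|m IHm]; first by rewrite c0.
  by rewrite -IHm -[RHS]step; congr (c _ 0%N); lia.
by rewrite -IHm -[LHS]step; congr (c _ 0%N); lia.
Qed.

Lemma inv_coef0 : inv_coef 0 = 1.
Proof.
by rewrite /inv_coef /wpow /conv big_ord1 mul0r mul0r addr0 pow_at0.
Qed.

Lemma inv_coef1 : inv_coef 1 = u 1.
Proof.
have [u0 c0 cS] := c_pow.
rewrite /inv_coef /wpow subrr c0 add0r /conv big_ord_recl big_ord1 /=.
by rewrite !mul0r add0r mul1r pow_at0 mulr1.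
Qed.

End Powers.

(** * Lagrange inversion and the recurrence *)

Lemma intr_mulI (A : idomainType) (a : int) (x y : A) :
  [pchar A] =i pred0 -> a != 0 -> a%:~R * x = a%:~R * y -> x = y.
Proof.
move=> /pcharf0P A0 a0; apply: mulfI; case: a a0 => m m0.
  by rewrite -pmulrn A0.
by rewrite NegzE mulrNz oppr_eq0 -pmulrn A0.
Qed.

Section Char0.

Variables (A : idomainType) (u : nat -> A) (c : int -> nat -> A).
Hypothesis c_pow : powers u c.
Hypothesis A_char0 : [pchar A] =i pred0.

Local Notation w := (wpow u c).
Local Notation q := (inv_coef u c).

(** For n > 0 the left-hand side is the residue of the derivative of
(z f)^(-n) / (- n). *)
Lemma wpow_residue n : w (- n%:Z) n = (n == 0%N)%:R.
Proof.
case: n => [|n].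
  by rewrite oppr0 /wpow /conv big_ord1 mul0r mul0r addr0 (pow_at0 c_pow).
apply: (intr_mulI (a := - n.+1%:Z) A_char0) => //.
by rewrite (wpowE c_pow) addNr mul0r mulr0.
Qed.

(** Both sides are multiplied by f when a increases by 1, and at a = - n only the
term i = n of the sum is left; there the identity is the definition of q_n. *)
Lemma lagrange_inversion a n :
  \sum_(i < n.+1) (i%:Z - 1)%:~R * q i * w (a + i%:Z) (n - i)%N = - c (a + 1) n.
Proof.
have [u0 c0 cS] := c_pow.
pose Z a n := \sum_(i < n.+1) (i%:Z - 1)%:~R * q i * w (a + i%:Z) (n - i)%N
              + c (a + 1) n.
apply/eqP; rewrite -addr_eq0 -/(Z a n); apply/eqP.
apply: (conv_shift_eq0 u0) => {a n} [a n|n].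
  rewrite /Z convDr -cS; congr (_ + _).
  pose s i := (i%:Z - 1)%:~R * q i.
  rewrite -(conv_exchange u s (fun i => w (a + i%:Z))).
  by apply: eq_bigr => i _; rewrite addrAC (wpowS c_pow).
exists (- n%:Z); rewrite /Z big_ord_recr /= subnn addNr big1 => [|i _].
  rewrite add0r (wpow_residue 0) mulr1 (addrC (- _) 1) -(inv_coefE c_pow).
  by rewrite -mulrDl -intrD addrC subrKA subrr mul0r.
rewrite (_ : - n%:Z + i%:Z = - (n - i)%N%:Z); last first.
    by have := ltn_ord i; lia.
by rewrite wpow_residue subn_eq0 leqNgt ltn_ord mulr0.
Qed.

(** Inversion at a = 1 - n, where the factor wpow is again a coefficient of Q. The
factor i - 1 becomes (n - 2) / 2 when i and n - i are exchanged. *)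
Lemma inv_coef_square n :
  (n%:Z - 2)%:~R * conv q q n = - (2 * c (2 - n%:Z) n).
Proof.
have half : \sum_(i < n.+1) (i%:Z - 1)%:~R * q i * q (n - i)%N = - c (2 - n%:Z) n.
  rewrite (_ : 2 - n%:Z = 1 - n%:Z + 1); last by lia.
  rewrite -lagrange_inversion; apply: eq_bigr => i _; congr (_ * w _ _).
  by have := ltn_ord i; lia.
have half' : \sum_(i < n.+1) ((n - i)%N%:Z - 1)%:~R * q i * q (n - i)%N
              = - c (2 - n%:Z) n.
  rewrite -half [RHS](reindex_inj rev_ord_inj) /=; apply: eq_bigr => i _.
  by rewrite subSS subKn -1?ltnS // mulrAC.
have -> : - (2 * c (2 - n%:Z) n) = - c (2 - n%:Z) n - c (2 - n%:Z) n by ring.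
rewrite -[in X in X - _]half -half' -big_split mulr_sumr.
apply: eq_bigr => i _ /=; rewrite -!mulrA -mulrDl -intrD; congr (_%:~R * _).
by have := ltn_ord i; lia.
Qed.

Lemma conv_inv_coef_ends k : (1 < k)%N ->
  conv q q k.+1 =
    2 * q k.+1 + 2 * u 1 * q k + \sum_(2 <= i < k) q i * q (k.+1 - i)%N.
Proof.
case: k => [|[|k]] // _; rewrite /conv.
rewrite big_ord_recl big_ord_recl !big_ord_recr /= /bump /=.
rewrite !subn0 !subnn subSS subn0 subSnn (inv_coef0 c_pow) (inv_coef1 c_pow).
rewrite [in RHS]big_add1 /= [in RHS]big_add1 /= big_mkord.
set S := \sum_(i < k) q i.+2 * q (k.+3 - i.+2)%N.
ring.
Qed.

(** The chain rule gives (1 - k) D q_k as a combination of q_k, q_(k+1) and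
c (1 - k) (k + 1), and inv_coef_square turns the latter into a convolution; its
four end terms account for the linear terms of the recurrence. *)
Lemma inv_coef_rec (D : A -> A) k :
    {morph D : x y / x + y} -> (forall x y, D (x * y) = D x * y + x * D y) ->
    (1 < k)%N ->
    (forall j, (0 < j <= k)%N -> D (u j) = (j + 2)%:R * u j.+1 - 2 * u 1 * u j) ->
  k.+2%:R * q k.+1 =
    D (q k) - (2 * k)%:R * u 1 * q k - \sum_(2 <= i < k) q i * q (k.+1 - i)%N.
Proof.
move=> D_add D_mul k_gt1 D_u; have [u0 c0 cS] := c_pow.
have D0 : D 0 = 0 by apply: (@addrI _ (D 0)); rewrite -D_add !addr0.
have D1 : D 1 = 0.
  by apply: (@addrI _ (D 1)); rewrite addr0 -[in RHS](mulr1 1) D_mul mulr1 mul1r.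
have DN x : D (- x) = - D x.
  by apply/eqP; rewrite -addr_eq0 -D_add addNr D0.
have Dnat m : D m%:R = 0.
  by elim: m => [|m IHm]; rewrite ?D0 // -natr1 D_add IHm D1 addr0.
have Dint a : D a%:~R = 0.
  by case: a => m; rewrite ?NegzE ?mulrNz ?DN -?pmulrn Dnat ?oppr0.
have Dq : (1 - k%:Z)%:~R * D (q k) = D (c (1 - k%:Z) k).
  by rewrite -(inv_coefE c_pow) D_mul Dint mul0r add0r.
have Dc : D (c (1 - k%:Z) k) =
    (1 - k%:Z)%:~R * (w (1 - k%:Z) k.+1 - c (- k%:Z) k.+1 - 2 * u 1 * c (1 - k%:Z) k).
  rewrite (power_rule c_pow (d := fun=> D)) //; congr (_ * _).
  rewrite (_ : 1 - k%:Z - 1 = - k%:Z); last by lia.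
  (* The formula for D u_j also holds for j = 0, where both sides are 0. *)
  have -> : conv (fun i => D (u i)) (c (- k%:Z)) k =
      conv (fun j => (j + 2)%:R * u j.+1) (c (- k%:Z)) k
      - 2 * u 1 * conv u (c (- k%:Z)) k.
    rewrite /conv mulr_sumr -sumrB; apply: eq_bigr => -[[|j] lt_jk] _ /=.
      by rewrite u0 D1; ring.
    by rewrite D_u 1?ltnS //; ring.
  rewrite -cS (addrC _ 1); congr (_ - _).
  rewrite /wpow (_ : 1 - k%:Z - 1 = - k%:Z); last by lia.
  rewrite (addrC 1) cS !conv_recl u0 mul1r !mul0r add0r.
  rewrite [RHS]addrC !addrA addNr add0r -[RHS]big_split; apply: eq_bigr => j _ /=.
  by rewrite natrD; ring.
apply: (intr_mulI (a := 1 - k%:Z) A_char0); first by lia.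
have e1 := inv_coefE c_pow k.
have := inv_coefE c_pow k.+1.
rewrite (_ : 1 - k.+1%:Z = - k%:Z) => [e2|]; last by lia.
have := inv_coef_square k.+1.
rewrite (_ : 2 - k.+1%:Z = 1 - k%:Z) => [e3|]; last by lia.
have := wpowE c_pow (1 - k%:Z) k.+1.
rewrite (_ : 1 - k%:Z + k.+1%:Z = 2) => [e4|]; last by lia.
rewrite !mulrBr Dq Dc !mulrBr e4 -e2 -e1.
have := conv_inv_coef_ends k_gt1; set S := \sum_(_ <= _ < _) _ => eS.
have {e3}: 2 * c (1 - k%:Z) k.+1 = (1 - k%:Z)%:~R *
   (2 * q k.+1 + 2 * u 1 * q k + S).
  rewrite -eS -[LHS]opprK -e3 -mulNr -mulrNz; congr (_%:~R * _); lia.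
move=> ->; rewrite -/S.
ring.
Qed.

End Char0.

(** * The binomial series *)

Lemma gbinom0 (F : fieldType) (a : F) : gbinom a 0 = 1.
Proof. by rewrite /gbinom big_ord0 fact0 divr1. Qed.

Lemma gbinom_pascal (F : fieldType) (a : F) n : [pchar F] =i pred0 ->
  gbinom (a + 1) n.+1 = gbinom a n.+1 + gbinom a n.
Proof.
move=> /pcharf0P F0; rewrite /gbinom big_ord_recl /= subr0 big_ord_recr /=.
under [X in (_ * X) / _]eq_bigr => i _.
  rewrite (_ : a + 1 - _ = a - i%:R); last by rewrite /bump /= natrD; ring.
  over.
by rewrite factS natrM; field; rewrite nat1r !F0 -lt0n fact_gt0.
Qed.

Lemma coef_exp_order0 (A : comNzRingType) (t : {poly A}) n k :
  t`_0 = 0 -> (k < n)%N -> (t ^+ n)`_k = 0.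
Proof.
move=> t0 lt_kn; have -> : t = drop_poly 1 t * 'X.
  rewrite -[t in LHS](poly_take_drop 1) expr1 [take_poly _ _](_ : _ = 0) ?add0r //.
  by apply/polyP => -[|i]; rewrite coef_take_poly coef0.
by rewrite exprMn coefMXn lt_kn.
Qed.

Lemma eq_coef_exp (A : nzRingType) (s t : {poly A}) n k :
  (forall i, (i <= k)%N -> s`_i = t`_i) -> (s ^+ n)`_k = (t ^+ n)`_k.
Proof.
elim: n k => [|n IHn] k eq_st; first by rewrite !expr0.
rewrite !exprS !coefM; apply: eq_bigr => i _; rewrite eq_st -1?ltnS //.
by rewrite IHn // => j le_j; apply: eq_st; rewrite (leq_trans le_j) ?leq_subr.
Qed.

(** The truncation order in the definition of spow varies with the coefficient; to
multiply series, a common order is needed. *)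
Lemma spow_widen (F : fieldType) (A : comAlgType F) (f : nat -> A) (a : F) k N :
    f 0%N = 1 -> (k <= N)%N ->
  spow f a k = \sum_(n < N.+1) gbinom a n *: ((\poly_(i < N.+1) f i - 1) ^+ n)`_k.
Proof.
move=> f0 le_kN; rewrite /spow.
pose coef n := gbinom a n *: ((\poly_(i < k.+1) f i - 1) ^+ n)`_k.
rewrite (big_ord_widen N.+1 coef) ?ltnS // /coef.
rewrite big_mkcond; apply: eq_bigr => n _; case: ltnP => le_nk.
  congr (_ *: _); apply: eq_coef_exp => i le_ik.
  by rewrite !coefB !coef_poly !ltnS le_ik (leq_trans le_ik le_kN).
by rewrite coef_exp_order0 ?scaler0 // coefB coef_poly /= f0 coef1 subrr.
Qed.

(** With f = 1 + t, the coefficient of t^n in (1 + t) (1 + t)^a is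
gbinom a n + gbinom a (n - 1) = gbinom (a + 1) n. *)
Lemma spow_powers (F : fieldType) (A : comAlgType F) (f : nat -> A) :
  [pchar F] =i pred0 -> f 0%N = 1 -> powers f (fun a => spow f a%:~R).
Proof.
move=> F0 f0; split=> // [n|a m].
  rewrite /spow big_ord_recl gbinom0 expr0 scale1r coef1 big1 ?addr0 // => i _.
  by rewrite /gbinom big_ord_recl /= subr0 !mul0r scale0r.
rewrite intrD (spow_widen _ f0 (leqnn m)).
have spow_le i : spow f a%:~R (m - i)%N = _ := spow_widen _ f0 (leq_subr i m).
set t := \poly_(i < m.+1) f i - 1 in spow_le *.
have t0 : t`_0 = 0 by rewrite coefB coef_poly /= f0 coef1 subrr.
have -> : conv f (spow f a%:~R) m =
    \sum_(n < m.+1) gbinom a%:~R n *: ((t ^+ n.+1)`_m + (t ^+ n)`_m).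
  rewrite /conv; under eq_bigr => i _ do rewrite spow_le mulr_sumr.
  rewrite exchange_big; apply: eq_bigr => n _ /=.
  rewrite exprS -coefD -[X in _ * _ + X]mul1r -mulrDl coefM scaler_sumr.
  apply: eq_bigr => i _; rewrite -scalerAr /t subrK coef_poly ltn_ord //.
under [RHS]eq_bigr => n _ do rewrite scalerDr.
rewrite big_split /= [X in _ = X + _]big_ord_recr /= coef_exp_order0 // scaler0 addr0.
rewrite big_ord_recl [X in _ = _ + X]big_ord_recl !gbinom0 addrCA -big_split.
by congr (_ + _); apply: eq_bigr => i _; rewrite gbinom_pascal // addrC scalerDl.
Qed.

Lemma spow_morph (F : fieldType) (A B : comAlgType F) (h : {lrmorphism A -> B})
    (f : nat -> A) (a : F) k :
  h (spow f a k) = spow (fun i => h (f i)) a k.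
Proof.
rewrite /spow linear_sum; apply: eq_bigr => n _; rewrite linearZ /=; congr (_ *: _).
rewrite -coef_map rmorphXn rmorphB rmorph1; congr (nth 0 (polyseq (( _ - 1) ^+ n)) k).
by apply/polyP => i; rewrite coef_map /= !coef_poly (fun_if h) rmorph0.
Qed.

(** * The polynomials of the statement *)

Definition useries (F : fieldType) (n i : nat) : {mpoly F[n]} :=
  if i == 0%N then 1 else uvar F n i.

Lemma Pmk0_comp (F : fieldType) (a : F) n k : (0 < k)%N ->
  Pmk a 0 k \mPo [tuple if i == ord0 then 1 else uvar F n i | i < (0 + k).+1] =
  spow (useries F n) a k.
Proof.
move=> k_gt0; have -> : Pmk a 0 k = spow (xser F (0 + k)) a k.
  rewrite -[LHS]mul1r -(expr0 'X_ord0) Pmk_spec /Pmk_num.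
  rewrite [X in _ - X](_ : _ = 0) ?subr0 // /spow.
  have -> : \poly_(i < (0 + k).+1) xser_trunc F (0 + k) 0 i = 1.
    by apply/polyP => -[|i]; rewrite coef_poly coef1 //= /xser_trunc if_same.
  rewrite big1 // => -[[|i] lt_i] _; rewrite subrr ?exprS ?mul0r ?coef0 ?scaler0 //.
  by rewrite expr0 coef1 /= eqn0Ngt k_gt0 scaler0.
set lq := mktuple _; rewrite (spow_morph (comp_mpoly lq)).
apply: eq_spow => -[|i] le_ik; first by rewrite /= rmorph1.
rewrite /= rmorphM rmorphXn /= !comp_mpolyXU -!tnth_nth !tnth_mktuple eqxx expr1n mulr1.
by rewrite -val_eqE /= inordK.
Qed.

Lemma uderivD (F : fieldType) n i : {morph @uderiv F n i : p q / p + q}.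
Proof.
case: i => [|i] p q /=; first by rewrite addr0.
by case: insub => [o|] /=; rewrite ?addr0 // mderivD.
Qed.

Lemma uderivM (F : fieldType) n i (p q : {mpoly F[n]}) :
  uderiv i (p * q) = uderiv i p * q + p * uderiv i q.
Proof.
case: i => [|i] /=; first by rewrite mul0r mulr0 addr0.
by case: insub => [o|] /=; rewrite ?mul0r ?mulr0 ?addr0 // mderivM.
Qed.

Lemma uderiv_uvar (F : fieldType) n i j : (0 < j <= n)%N ->
  uderiv i (uvar F n j) = (i == j)%:R.
Proof.
case: i j => [|i] [|j] //= lt_jn; rewrite eqSS [insub j]insubT /=.
case: insubP => [o _ <-|] /=; last by rewrite -leqNgt; case: eqP => // ->; lia.
rewrite mderivX mnm1E -val_eqE /= eq_sym; case: eqP => [eq_oj|_]; last by rewrite scale0r.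
rewrite scale1r (_ : Sub j lt_jn = o); last exact: val_inj.
by rewrite -{1}[U_(o)%MM]add0m addmK mpolyX0.
Qed.

(** The derivation D, cut off to a finite sum; the cut-off is harmless on
polynomials in u_1, ..., u_k. *)
Definition uflow (F : fieldType) (n k : nat) (p : {mpoly F[n]}) : {mpoly F[n]} :=
  \sum_(1 <= i < k.+1)
    (uvar F n i.+1 *+ (i + 2) - uvar F n 1 * uvar F n i *+ 2) * uderiv i p.

Lemma uflow_uvar (F : fieldType) n k j : (k <= n)%N -> (0 < j <= k)%N ->
  uflow k (uvar F n j) = uvar F n j.+1 *+ (j + 2) - uvar F n 1 * uvar F n j *+ 2.
Proof.
move=> le_kn /andP[j_gt0 le_jk]; rewrite /uflow.
rewrite (bigD1_seq j) ?mem_index_iota ?iota_uniq ?j_gt0 //=.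
rewrite uderiv_uvar ?j_gt0 ?(leq_trans le_jk) // eqxx mulr1 big1 ?addr0 // => i ne_ij.
by rewrite uderiv_uvar ?j_gt0 ?(leq_trans le_jk) // (negPf ne_ij) mulr0.
Qed.

Lemma uflowD (F : fieldType) n k : {morph @uflow F n k : p q / p + q}.
Proof.
by move=> p q; rewrite /uflow -big_split; apply: eq_bigr => i _; rewrite uderivD mulrDr.
Qed.

Lemma uflowM (F : fieldType) n k (p q : {mpoly F[n]}) :
  uflow k (p * q) = uflow k p * q + p * uflow k q.
Proof.
rewrite /uflow mulr_suml mulr_sumr -big_split; apply: eq_bigr => i _.
by rewrite uderivM mulrDr mulrA mulrCA.
Qed.

Lemma Pu_inv_coef (F : fieldType) (n k : nat) :
    [pchar F] =i pred0 -> (1 < k)%N -> (k <= n)%N ->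
  Pu F n k = inv_coef (useries F n) (fun a => spow (useries F n) a%:~R) k.
Proof.
move=> charF; have char0 : [pchar {mpoly F[n]}] =i pred0.
  by move=> p; rewrite pchar_lalg charF.
have F0 := (pcharf0P F).1 charF.
have c_pow := spow_powers (f := useries F n) charF erefl.
set u := useries F n in c_pow *; set c := fun a : int => _ in c_pow *.
elim/ltn_ind: k => -[|[|[|k]]] // IHk _ le_kn.
  have [u0 c0 cS] := c_pow.
  (* The case k = 2: the coefficients of 1 / f up to z^2. *)
  have c_inv m : \sum_(i < m.+1) u i * c (-1) (m - i)%N = (m == 0%N)%:R.
    by rewrite -c0 -[0 in RHS](addNr 1) cS.
  have /eqP := c_inv 1%N; rewrite !big_ord_recr big_ord0 /= (pow_at0 c_pow) u0.
  rewrite add0r mul1r mulr1 addr_eq0 => /eqP c11.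
  have /eqP := c_inv 2%N; rewrite !big_ord_recr big_ord0 /= (pow_at0 c_pow) u0.
  rewrite add0r mul1r mulr1 -addrA addr_eq0 c11 => /eqP c12.
  apply: (intr_mulI (a := -1) char0) => //; rewrite (inv_coefE c_pow 2) Pu2.
  by rewrite c12 -[u 1%N]/(uvar F n 1) -[u 2%N]/(uvar F n 2); ring.
rewrite PuS // /Pu_next.
apply: (canLR (scalerK _)); first by rewrite F0.
rewrite scaler_nat -[RHS]mulr_natl.
rewrite (inv_coef_rec c_pow char0 (@uflowD F n k.+2) (@uflowM F n k.+2)) //; last first.
  move=> j /[dup] j_bnd /andP[j_gt0 le_jk].
  have uE i : (0 < i)%N -> u i = uvar F n i by case: i.
  rewrite !uE // uflow_uvar //; last by rewrite ltnW.
  by ring.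
rewrite -IHk //; last by rewrite ltnW.
rewrite -mulrA mulr_natl; congr (_ - _ - _).
apply: eq_big_nat => i /andP[i_ge2 lt_ik].
by rewrite !IHk //; lia.
Qed.

Theorem theorem10 (n k : nat) (k_gt1 : (1 < k)%N) (le_kn : (k <= n)%N) :
  Pu rat n k =
    (1 - k%:R)^-1 *:
      (Pmk (1 - k%:R : rat) 0 k
         \mPo [tuple if i == ord0 then 1 else uvar rat n i | i < (0 + k).+1]).
Proof.
have char0 := @Num.Theory.pchar_num rat.
have c_pow := spow_powers (f := useries rat n) char0 erefl.
rewrite Pmk0_comp ?(ltnW k_gt1) // Pu_inv_coef //.
have -> : (1 - k%:R : rat) = (1 - k%:Z)%:~R by rewrite intrB -pmulrn.
rewrite -(inv_coefE c_pow k) mulrzl -scaler_int scalerK //.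
by rewrite intr_eq0; lia.
Qed.
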